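(* Let $\alpha > 0$ and let $\mathbb{X} = \mathbb{R}^2$ be endowed with a norm such that the unit sphere $S_{\mathbb{X}}$ is a hexagon, four of whose vertices are $\pm(1,\alpha)$ and $\pm(1,-\alpha)$. Then $\mathbb{X}$ is a Radon plane if and only if the other two vertices of $S_{\mathbb{X}}$ are $\pm(0, 2\alpha)$ or $\pm(2, 0)$.
   Context: For a norm $\|\cdot\|$ on $\mathbb{R}^2$, $S_{\mathbb{X}} = \{x : \|x\| = 1\}$. $S_{\mathbb{X}}$ is a hexagon if the unit ball has exactly six extreme points; these are its vertices. Birkhoff-James orthogonality: $x \perp_B y$ means $\|x + \lambda y\| \ge \|x\|$ for all $\lambda \in \mathbb{R}$. $\mathbb{X}$ is a Radon plane if $\perp_B$ is symmetric, i.e. $x \perp_B y$ implies $y \perp_B x$ for all $x, y \in \mathbb{X}$. *)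

(* Defs.v *)
From mathcomp Require Import all_boot all_order all_algebra.
From mathcomp Require Import all_classical all_reals.

Set Implicit Arguments.
Unset Strict Implicit.
Unset Printing Implicit Defensive.

Import Order.TTheory GRing.Theory Num.Theory.
Local Open Scope classical_set_scope.
Local Open Scope ring_scope.

(* The norm is a function [N] rather than a [normedModType] instance, because
   the theorem quantifies over the norms on one fixed space, R^2, which already
   carries a canonical norm.  The fields are those of [Lmodule_isNormed];
   nonnegativity follows from them. *)
Record is_norm (R : realType) (V : lmodType R) (N : V -> R) : Prop := IsNorm {
  norm_triangle : forall x y, N (x + y) <= N x + N y;
  norm_scale : forall (l : R) x, N (l *: x) = `|l| * N x;
  norm_eq0 : forall x, N x = 0 -> x = 0 }.

Definition unit_ball (R : realType) (V : lmodType R) (N : V -> R) : set V :=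
  [set x | N x <= 1].

Definition extreme_points (R : realType) (V : lmodType R) (A : set V) : set V :=
  [set x | A x /\ forall (y z : V) (t : R), A y -> A z -> 0 < t < 1 ->
             x = t *: y + (1 - t) *: z -> y = x /\ z = x].

Definition vertices (R : realType) (V : lmodType R) (N : V -> R) : set V :=
  extreme_points (unit_ball N).

Definition is_hexagon (R : realType) (V : lmodType R) (N : V -> R) : Prop :=
  (vertices N #= `I_6)%card.

Definition birkhoff_james (R : realType) (V : lmodType R) (N : V -> R)
    (x y : V) : Prop :=
  forall l : R, N x <= N (x + l *: y).

Definition is_radon (R : realType) (V : lmodType R) (N : V -> R) : Prop :=
  forall x y : V, birkhoff_james N x y -> birkhoff_james N y x.

(* [R^o] is [R] as a module over itself, so that the product is an [lmodType]. *)
Definition plane (R : realType) : lmodType R := (R^o * R^o)%type.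

Definition pt (R : realType) (x y : R) : plane R := (x, y).

Definition pm (R : realType) (V : lmodType R) (v : V) : set V := [set v; - v].

(* Main.v *)
(* Let e, f be vertices and let w = a e + b f be the remaining one; after sign
   changes a, b > 0, so the norm is s + t on each of the cones (e, w), (w, f),
   (f, -e) spanned by adjacent vertices.
   If the plane is Radon, then e and -f are orthogonal to e + f, the direction
   of their edge, hence e + f is orthogonal to e and to f.  At an interior point
   of an edge only the direction of the edge is orthogonal, so e + f is a
   multiple of w, i.e. a = b; since also w - e is orthogonal to e, the same
   argument gives a = 1.
   Conversely, if w = e + f then, in coordinates, the norm is
   max(|x1|, |x2|, |x1 - x2|), which up to a factor is its own dual norm under
   the determinant; orthogonality of x and y then means that |det(x, y)| attains
   its bound, a symmetric condition. *)

Require Import Defs.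
From mathcomp Require Import all_boot all_order all_algebra.
From mathcomp Require Import all_classical all_reals all_analysis.
From mathcomp Require Import ring lra.

Set Implicit Arguments.
Unset Strict Implicit.

Import Order.TTheory GRing.Theory Num.Theory.
Import numFieldNormedType.Exports.
Local Open Scope classical_set_scope.
Local Open Scope ring_scope.

(** * Minimizers on the unit interval *)

(** The minimizers in [0, 1] have a supremum, and the Lipschitz bound makes it a minimizer too.
    Being the last one, it will mark an end of a face of the unit ball. *)
Lemma lipschitz_last_min (R : realType) (h : R -> R) (k : R) :
  (forall s t, `|h s - h t| <= k * `|s - t|) ->
  exists c, [/\ 0 <= c <= 1, forall t, 0 <= t <= 1 -> h c <= h t &
                forall t, 0 <= t <= 1 -> h t <= h c -> t <= c].
Proof.
move=> hk.
have k0 : 0 <= k.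
  by have := hk 1 0; rewrite subr0 normr1 mulr1; apply/le_trans/normr_ge0.
have k1 : 0 < k + 1 by rewrite ltr_wpDl.
have hcont : continuous h.
  move=> x; apply/cvgrPdist_lt => e e0.
  near=> y; apply: le_lt_trans (hk x y) _.
  apply: (@le_lt_trans _ _ ((k + 1) * `|x - y|)).
    by rewrite ler_wpM2r// lerDl.
  rewrite mulrC -ltr_pdivlMr//; near: y.
  by apply: cvgr_dist_lt; [exact: cvg_id|exact: divr_gt0].
have [d d01 dmin] : exists2 d, d \in `[0, 1]%R &
    forall t, t \in `[0, 1]%R -> h d <= h t.
  by apply: EVT_min => //; exact: continuous_subspaceT.
pose S := [set t | 0 <= t <= 1 /\ h t <= h d].
have Sd : S d by split => //; move: d01; rewrite in_itv.
have supS : has_sup S by split; [exists d|exists 1 => t [/andP[]]].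
have S0 : 0 <= sup S.
  apply: le_trans (sup_upper_bound supS Sd).
  by case: Sd => /andP[].
have S1 : sup S <= 1 by apply: ge_sup => [|t [/andP[]]//]; exists d.
have hS : h (sup S) <= h d.
  apply/ler_addgt0Pr => e e0.
  have [t [t01 htd] tS] := sup_adherent (divr_gt0 e0 k1) supS.
  have tle : t <= sup S by exact: sup_upper_bound.
  have := le_trans (ler_norm _) (hk (sup S) t).
  rewrite ger0_norm ?subr_ge0// => hle.
  have : (sup S - t) * (k + 1) < e.
    by rewrite -ltr_pdivlMr// ltrBlDr addrC -ltrBlDr.
  nra.
exists (sup S); split => [|t t01|t t01 ht].
- by rewrite S0.
- by apply: le_trans hS _; apply: dmin; rewrite in_itv.
- by apply: (sup_upper_bound supS); split => //; exact: le_trans hS.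
Unshelve. all: by end_near. Qed.

(** * Coordinates and determinants in the plane *)

Section plane.
Variable R : realType.
Implicit Types (u v x y : plane R) (s t : R).

Definition det u v : R := (u.1 : R) * v.2 - (u.2 : R) * v.1.

Lemma plane_eq x y : x.1 = y.1 -> x.2 = y.2 -> x = y.
Proof. by case: x y => [? ?] [? ?] /= -> ->. Qed.

Lemma planeE : (forall x y, (x + y).1 = (x.1 : R) + y.1 :> R) *
  (forall x y, (x + y).2 = (x.2 : R) + y.2 :> R) *
  (forall x, (- x).1 = - (x.1 : R) :> R) *
  (forall x, (- x).2 = - (x.2 : R) :> R) *
  (forall s x, (s *: x).1 = s * x.1 :> R) *
  (forall s x, (s *: x).2 = s * x.2 :> R).
Proof. by []. Qed.

Lemma det_decomp u v x : det u v != 0 ->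
  exists s t, x = s *: u + t *: v.
Proof.
rewrite /det => uv0.
exists ((x.1 * v.2 - x.2 * v.1) / (u.1 * v.2 - u.2 * v.1)),
       ((u.1 * x.2 - u.2 * x.1) / (u.1 * v.2 - u.2 * v.1)).
by apply: plane_eq; rewrite !planeE; field.
Qed.

Lemma det_inj u v s t s' t' : det u v != 0 ->
  s *: u + t *: v = s' *: u + t' *: v -> s = s' /\ t = t'.
Proof.
rewrite /det => uv0 e.
have := congr1 fst e; have := congr1 snd e; rewrite !planeE => e2 e1.
split; apply: (mulIf uv0).
  have -> : s * (u.1 * v.2 - u.2 * v.1) =
    (s * u.1 + t * v.1) * v.2 - (s * u.2 + t * v.2) * v.1 by ring.
  by rewrite e1 e2; ring.
have -> : t * (u.1 * v.2 - u.2 * v.1) =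
  (s * u.2 + t * v.2) * u.1 - (s * u.1 + t * v.1) * u.2 by ring.
by rewrite e1 e2; ring.
Qed.

End plane.

Ltac vec := apply: plane_eq; rewrite !planeE /=; (ring || (field; done)).

(** * Vertices and edges of the unit ball *)

Section norm.
Variables (R : realType) (N : plane R -> R).
Hypothesis hN : is_norm N.
Implicit Types (u v x y : plane R) (s t : R).

Lemma normN x : N (- x) = N x.
Proof. by rewrite -scaleN1r (norm_scale hN) normrN1 mul1r. Qed.

Lemma norm0 : N 0 = 0.
Proof. by rewrite -(scale0r 0) (norm_scale hN) normr0 mul0r. Qed.

Lemma norm_ge0 x : 0 <= N x.
Proof. by have := norm_triangle hN x (- x); rewrite subrr norm0 normN; lra. Qed.

Lemma norm_comb s t u v : N (s *: u + t *: v) <= `|s| * N u + `|t| * N v.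
Proof. by rewrite -!(norm_scale hN); exact: norm_triangle. Qed.

(** If [N x < 1], then [x] is the midpoint of [x + e v] and [x - e v], which stay in the ball for
    [e = (1 - N x) / N v]. *)
Lemma vertex_norm1 v x : v != 0 -> vertices N x -> N x = 1.
Proof.
move=> v0 [/= Nx1 ext]; apply/eqP; rewrite eq_le Nx1 leNgt /=.
apply/negP => Nx_lt1.
have Nv0 : N v != 0 by apply: contra_neq v0 => /(norm_eq0 hN).
have Nv : 0 < N v by rewrite lt_def Nv0 norm_ge0.
pose e := (1 - N x) / N v.
have e0 : 0 < e by rewrite divr_gt0// subr_gt0.
have ball s : `|s| = e -> N (x + s *: v) <= 1.
  move=> se; apply: le_trans (norm_triangle hN _ _) _.
  by rewrite (norm_scale hN) se divfK// addrC subrK.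
have [||||_ /eqP] := ext (x + e *: v) (x + (- e) *: v) 2^-1.
- by apply: ball; rewrite gtr0_norm.
- by apply: ball; rewrite normrN gtr0_norm.
- by lra.
- by vec.
rewrite -subr_eq0 addrC addKr scaler_eq0 oppr_eq0 (negbTE v0) orbF => /eqP.
lra.
Qed.

Lemma vertexN x : vertices N x -> vertices N (- x).
Proof.
move=> [/= Nx ext]; split=> [|y z t]; first by rewrite /unit_ball /= normN.
rewrite /unit_ball /= -(normN y) -(normN z) => Ny Nz t01 xyz.
have [|yx zx] := ext _ _ _ Ny Nz t01.
  by rewrite -[LHS]opprK xyz opprD !scalerN.
by split; [rewrite -yx|rewrite -zx]; rewrite opprK.
Qed.

(** [m] is the minimum of the norm on the line through [u] and [v], attained on the segment between
    them; homogeneity extends the bound to all [s], [t]. Since [c] is the last minimizer, the face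
    where [m (s + t) = 1] does not go beyond [c] towards [v]. *)
Lemma norm_segment_min u v : det u v != 0 -> N u = 1 -> N v = 1 ->
  exists c, let m := N ((1 - c) *: u + c *: v) in
  [/\ 0 < m <= 1, forall s t, m * (s + t) <= N (s *: u + t *: v) &
      m < 1 -> 0 < c < 1 /\ forall s t, m * (s + t) = 1 ->
        N (s *: u + t *: v) <= 1 -> m * t <= c].
Proof.
move=> uv0 Nu Nv.
pose h t := N ((1 - t) *: u + t *: v).
have h0 : h 0 = 1 by rewrite /h subr0 scale1r scale0r addr0.
have h1 : h 1 = 1 by rewrite /h subrr scale1r scale0r add0r.
have hlip s t : `|h s - h t| <= N (v - u) * `|s - t|.
  have sub a b : h a - h b <= N (v - u) * `|a - b|.
    rewrite lerBlDl mulrC -(norm_scale hN).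
    apply: le_trans (norm_triangle hN _ _); rewrite le_eqVlt; apply/orP; left.
    by apply/eqP; congr N; vec.
  by rewrite ler_norml sub lerNl opprB distrC sub.
have [c [c01 cmin clast]] := lipschitz_last_min hlip.
have conv a b r : 0 <= r <= 1 ->
    h ((1 - r) * a + r * b) <= (1 - r) * h a + r * h b.
  move=> /andP[r0 r1].
  have -> : h ((1 - r) * a + r * b) = N ((1 - r) *: ((1 - a) *: u + a *: v) +
     r *: ((1 - b) *: u + b *: v)) by congr N; vec.
  apply: le_trans (norm_comb _ _ _ _) _.
  by rewrite !ger0_norm// subr_ge0.
(* For [t] outside [0, 1], one of 0 and 1 lies between [t] and the other; [h] is 1 at both, so
   convexity applies. *)
have hout t : t < 0 \/ 1 < t -> 1 <= h t.
  move=> [t0|t1].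
    have r01 : 0 <= (1 - t)^-1 <= 1.
      by rewrite invr_ge0 subr_ge0 (le_trans (ltW t0))//= invf_le1; lra.
    have := conv 1 t _ r01.
    have -> : (1 - (1 - t)^-1) * 1 + (1 - t)^-1 * t = 0 by field; lra.
    rewrite h0 h1 mulr1 => H.
    have : (1 - t)^-1 * 1 <= (1 - t)^-1 * h t by lra.
    by rewrite ler_pM2l// invr_gt0; lra.
  have r01 : 0 <= t^-1 <= 1 by rewrite invr_ge0 invf_le1; lra.
  have := conv 0 t _ r01.
  have -> : (1 - t^-1) * 0 + t^-1 * t = 1 by field; lra.
  rewrite h0 h1 mulr1 => H.
  have : t^-1 * 1 <= t^-1 * h t by lra.
  by rewrite ler_pM2l// invr_gt0; lra.
have hc1 : h c <= 1 by rewrite -h0; apply: cmin; lra.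
have gmin t : h c <= h t.
  have [t0|t0] := ltP t 0; first by apply: le_trans hc1 (hout _ _); left.
  have [t1|t1] := ltP 1 t; first by apply: le_trans hc1 (hout _ _); right.
  by apply: cmin; rewrite t0.
have hst s t : 0 < s + t ->
    N (s *: u + t *: v) = (s + t) * h (t / (s + t)).
  move=> st0; rewrite -[X in X * _](gtr0_norm st0) -(norm_scale hN); congr N.
  by have st := lt0r_neq0 st0; vec.
exists c => /=; rewrite -/(h c); split.
- rewrite hc1 andbT lt_def norm_ge0 andbT; apply/eqP => /(norm_eq0 hN) e.
  have [] := @det_inj _ _ _ _ _ 0 0 uv0 (etrans e _); first by vec.
  lra.
- move=> s t; have [st|st] := leP (s + t) 0.
    apply: le_trans (norm_ge0 _); apply: mulr_ge0_le0 => //; exact: norm_ge0.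
  by rewrite hst// mulrC ler_pM2l.
move=> hclt1; split.
  rewrite !lt_def -!andbA; case/andP: (c01) => -> ->; rewrite !andbT.
  apply/andP; split; apply/eqP => ce.
    by move: hclt1; rewrite ce h0 ltxx.
  by move: hclt1; rewrite -ce h1 ltxx.
move=> s t st1 Nst.
have hcpos : 0 < h c.
  rewrite lt_def norm_ge0 andbT; apply/eqP => e.
  by move: st1; rewrite e mul0r => /esym/eqP; rewrite oner_eq0.
have st0 : 0 < s + t by rewrite -(pmulr_rgt0 _ hcpos) st1.
(* Scaled to the line through [u] and [v], the point has parameter [t / (s + t)], so this parameter
   is again a minimizer. *)
have ht : h (h c * t) <= h c.
  have -> : h c * t = t / (s + t).
    apply: (mulIf (lt0r_neq0 st0)); rewrite divfK ?lt0r_neq0//.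
    by rewrite mulrAC st1 mul1r.
  rewrite -(ler_pM2l st0) -hst// mulrC st1; exact: Nst.
have [t0|t0] := ltP (h c * t) 0; first by have := hout _ (or_introl t0); lra.
have [t1|t1] := ltP 1 (h c * t); first by have := hout _ (or_intror t1); lra.
by apply: clast; rewrite ?t0.
Qed.

(* Otherwise, the functional [s u + t v |-> s + t] exceeds 1 somewhere on the
   ball; the face where it is maximal lies inside the open cone, and the end of
   this face which is nearest to [v] is a vertex. *)
Lemma edge_norm_ge u v : det u v != 0 -> N u = 1 -> N v = 1 ->
  (forall s t, 0 < s -> 0 < t -> ~ vertices N (s *: u + t *: v)) ->
  forall s t, s + t <= N (s *: u + t *: v).
Proof.
move=> uv0 Nu Nv nov.
have [c /=] := norm_segment_min uv0 Nu Nv.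
set m := N _ => -[/andP[m0 m1] mmin mlast].
have [mlt1|] := ltP m 1; last first.
  by move=> m1' s t; have := mmin s t; rewrite (_ : m = 1) ?mul1r//; lra.
have [/andP[c0 c1] clast] := mlast mlt1.
have mN0 := lt0r_neq0 m0.
(* The last minimizer, scaled to norm 1, is the forbidden vertex. *)
exfalso; apply: (nov ((1 - c) / m) (c / m)).
- by rewrite divr_gt0// subr_gt0.
- by rewrite divr_gt0.
have xE : ((1 - c) / m) *: u + (c / m) *: v = m^-1 *: ((1 - c) *: u + c *: v).
  by vec.
split.
  by rewrite /unit_ball /= xE (norm_scale hN) -/m gtr0_norm ?invr_gt0// mulVf.
move=> y z r.
have [s [t ->]] := det_decomp y uv0.
have [s' [t' ->]] := det_decomp z uv0.
rewrite /unit_ball /= => Ny Nz /andP[r0 r1] e.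
have := mmin s t; have := mmin s' t' => zle yle.
have [e1 e2] : (1 - c) / m = r * s + (1 - r) * s' /\
               c / m = r * t + (1 - r) * t'.
  by apply: det_inj uv0 _; rewrite e; vec.
have {}e1 : 1 - c = r * (m * s) + (1 - r) * (m * s').
  by apply: (mulIf (invr_neq0 mN0)); rewrite e1; field.
have {}e2 : c = r * (m * t) + (1 - r) * (m * t').
  by apply: (mulIf (invr_neq0 mN0)); rewrite e2; field.
(* The functional [m (s + t)] is at most 1 at both ends and averages to 1, so both ends lie on the
   face. There [m t] is at most [c] and averages to [c], so both ends are the given point. *)
rewrite mulrDr in zle; rewrite mulrDr in yle.
have sty : m * s + m * t = 1 by nra.
have stz : m * s' + m * t' = 1 by nra.
have ty := clast s t; have tz := clast s' t'.
rewrite mulrDr in ty; rewrite mulrDr in tz.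
have {}ty := ty sty Ny; have {}tz := tz stz Nz.
have mt : m * t = c by nra.
have mt' : m * t' = c by nra.
have E1 : t = c / m by rewrite -mt mulrC mulKf.
have E2 : t' = c / m by rewrite -mt' mulrC mulKf.
have E3 : s = (1 - c) / m by apply: (canRL (mulfK mN0)); lra.
have E4 : s' = (1 - c) / m by apply: (canRL (mulfK mN0)); lra.
by rewrite E1 E2 E3 E4.
Qed.

End norm.

(** * Determinant bound for the hexagonal norm *)

(** On each of the six cones given by the signs of [x1], [x2] and [x1 - x2], the determinant is a
    combination of two of the numbers [y1], [y2], [y1 - y2], up to sign, with nonnegative
    coefficients whose sum is at most [X]. *)
Lemma hexagon_det_le (R : realDomainType) (x1 x2 y1 y2 X Y : R) :
  `|x1| <= X -> `|x2| <= X -> `|x1 - x2| <= X ->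
  `|y1| <= Y -> `|y2| <= Y -> `|y1 - y2| <= Y ->
  `|x1 * y2 - x2 * y1| <= X * Y.
Proof.
move=> hx1 hx2 hx3; rewrite !ler_norml.
move=> /andP[hy1 hy1'] /andP[hy2 hy2'] /andP[hy3 hy3'].
have comb s t p q : 0 <= s -> 0 <= t -> s + t <= X -> p <= Y -> q <= Y ->
    s * p + t * q <= X * Y.
  move=> s0 t0 st pY qY.
  apply: (@le_trans _ _ ((s + t) * Y)); last by rewrite ler_wpM2r; lra.
  by rewrite mulrDl lerD// ler_wpM2l.
have half z1 z2 : `|z1| <= X -> `|z2| <= X -> `|z1 - z2| <= X ->
    z1 * y2 - z2 * y1 <= X * Y.
  rewrite !ler_norml => /andP[hz1 hz1'] /andP[hz2 hz2'] /andP[hz3 hz3'].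
  have [p1|p1] := leP 0 z1; have [p2|p2] := leP 0 z2.
  - have [p3|p3] := leP z1 z2.
      rewrite (_ : _ - _ = z1 * (y2 - y1) + (z2 - z1) * - y1); last by ring.
      by apply: comb; lra.
    rewrite (_ : _ - _ = (z1 - z2) * y2 + z2 * (y2 - y1)); last by ring.
    by apply: comb; lra.
  - rewrite (_ : _ - _ = z1 * y2 + - z2 * y1); last by ring.
    by apply: comb; lra.
  - rewrite (_ : _ - _ = - z1 * - y2 + z2 * - y1); last by ring.
    by apply: comb; lra.
  have [p3|p3] := leP z1 z2.
    rewrite (_ : _ - _ = (z2 - z1) * - y2 + - z2 * (y1 - y2)); last by ring.
    by apply: comb; lra.
  rewrite (_ : _ - _ = - z1 * (y1 - y2) + (z1 - z2) * y1); last by ring.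
  by apply: comb; lra.
rewrite half// andbT lerNl (_ : - _ = - x1 * y2 - - x2 * y1); last by ring.
by apply: half; rewrite -?opprD normrN.
Qed.

(** * Orthogonality along edges and through determinants *)

Section radon.
Variables (R : realType) (N : plane R -> R).
Hypothesis hN : is_norm N.
Implicit Types (u v x y : plane R) (s t : R).

(** The functional [s + t] bounds the norm from below, equals it on the cone, and is constant in the
    direction [v - u]. *)
Lemma bj_edge u v : N u = 1 -> N v = 1 ->
  (forall s t, s + t <= N (s *: u + t *: v)) ->
  forall s t r, 0 <= s -> 0 <= t ->
  birkhoff_james N (s *: u + t *: v) (r *: (v - u)).
Proof.
move=> Nu Nv edge s t r s0 t0 l.
apply: le_trans (norm_comb hN _ _ _ _) _.
rewrite Nu Nv !mulr1 !ger0_norm//.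
have -> : s *: u + t *: v + l *: (r *: (v - u)) =
  (s - l * r) *: u + (t + l * r) *: v by vec.
by apply: le_trans (edge _ _); lra.
Qed.

(** Near an interior point of the cone the norm is the linear functional [s + t], which has a
    minimum along a line only if it is constant on it. *)
Lemma bj_edge_interior u v : N u = 1 -> N v = 1 ->
  (forall s t, s + t <= N (s *: u + t *: v)) ->
  forall s t a b, 0 < s -> 0 < t ->
  birkhoff_james N (s *: u + t *: v) (a *: u + b *: v) -> a + b = 0.
Proof.
move=> Nu Nv edge s t a b s0 t0 bj.
(* With [e = min(s, t) / k], a move by [e] or [- e] along the line keeps both coordinates
   nonnegative. *)
pose k := `|a| + `|b| + 1.
have k0 : 0 < k by rewrite ltr_wpDl// addr_ge0.
pose e := Num.min s t / k.
have m0 : 0 < Num.min s t by rewrite lt_min s0.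
have e0 : 0 < e by rewrite divr_gt0.
have ek : e * k = Num.min s t by rewrite divfK// lt0r_neq0.
have ms : Num.min s t <= s by rewrite ge_min lexx.
have mt : Num.min s t <= t by rewrite ge_min lexx orbT.
have ea : e * `|a| <= Num.min s t.
  by rewrite -ek ler_pM2l// /k; have := normr_ge0 b; lra.
have eb : e * `|b| <= Num.min s t.
  by rewrite -ek ler_pM2l// /k; have := normr_ge0 a; lra.
have step l : `|l| = e -> 0 <= l * (a + b).
  move=> le.
  have la : - (e * `|a|) <= l * a by rewrite -le -normrM lerNl -normrN ler_norm.
  have lb : - (e * `|b|) <= l * b by rewrite -le -normrM lerNl -normrN ler_norm.
  have := le_trans (edge s t) (bj l).
  have -> : s *: u + t *: v + l *: (a *: u + b *: v) =
    (s + l * a) *: u + (t + l * b) *: v by vec.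
  move=> H; have := le_trans H (norm_comb hN _ _ _ _).
  rewrite Nu Nv !mulr1 !ger0_norm; lra.
have h1 := step e (gtr0_norm e0).
have h2 := step (- e) (etrans (normrN _) (gtr0_norm e0)).
have : e * (a + b) = 0 by lra.
by move/eqP; rewrite mulf_eq0 (negbTE (lt0r_neq0 e0)) => /eqP.
Qed.

(** Write [x = s z + t y]. Orthogonality gives [N x <= N (s z) = |s|], while
    [det x y = s det z y]. *)
Lemma bj_det d x y : 0 < d ->
  (exists2 z, N z = 1 & d * N y <= `|det z y|) ->
  birkhoff_james N x y -> d * (N x * N y) <= `|det x y|.
Proof.
move=> d0 [z Nz zy] bj.
have [->|y0] := eqVneq y 0; first by rewrite norm0// !mulr0 normr_ge0.
have Ny : 0 < N y.
  rewrite lt_def norm_ge0// andbT; apply: contra_neq y0; exact: norm_eq0.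
have dzy : det z y != 0.
  by rewrite -normr_gt0; apply: lt_le_trans zy; exact: mulr_gt0.
have [s [t xE]] := det_decomp x dzy.
have := bj (- t).
have -> : x + - t *: y = s *: z by rewrite xE; vec.
rewrite (norm_scale hN) Nz mulr1 => Nx.
have -> : det x y = s * det z y by rewrite xE /det !planeE; ring.
rewrite normrM mulrCA; apply: ler_pM => //; first exact: norm_ge0.
by apply: mulr_ge0; exact: ltW.
Qed.

(* The hypotheses say that the norm is its own dual norm under [det / d]. *)
Lemma radon_of_det d : 0 < d ->
  (forall z z', `|det z z'| <= d * (N z * N z')) ->
  (forall y, exists2 z, N z = 1 & d * N y <= `|det z y|) -> is_radon N.
Proof.
move=> d0 detN dual x y bj l.
have [->|x0] := eqVneq x 0; first by rewrite scaler0 addr0.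
have Nx : 0 < N x.
  rewrite lt_def norm_ge0// andbT; apply: contra_neq x0; exact: norm_eq0.
rewrite -(ler_pM2l Nx) -(ler_pM2l d0).
apply: le_trans (bj_det d0 (dual y) bj) _.
(* The determinant does not see the multiple of [x], so its upper bound gives the orthogonality for
   every [l]. *)
have -> : det x y = det x (y + l *: x) by rewrite /det !planeE; ring.
exact: detN.
Qed.

Lemma edge_norm_geN u v : (forall s t, s + t <= N (s *: u + t *: v)) ->
  forall s t, s + t <= N (s *: (- u) + t *: (- v)).
Proof. by move=> edge s t; rewrite !scalerN -opprD normN. Qed.

(** * Radon hexagons in the basis of two vertices *)

Section hexagon.
Variables (e f : plane R) (a b : R).
Let w := a *: e + b *: f.
Hypothesis ef0 : det e f != 0.
Hypotheses (a0 : 0 < a) (b0 : 0 < b).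
Hypotheses (Ne : N e = 1) (Nf : N f = 1) (Nw : N w = 1).
Hypothesis vert : vertices N `<=` pm e `|` pm f `|` pm w.

Lemma vert_coord s t : vertices N (s *: e + t *: f) ->
  t = 0 \/ s = 0 \/ s = a /\ t = b \/ s = - a /\ t = - b.
Proof.
case/vert => [[[]|[]]|[]] E.
- left; have [] := @det_inj _ _ _ s t 1 0 ef0; last by [].
  by rewrite E; vec.
- left; have [] := @det_inj _ _ _ s t (-1) 0 ef0; last by [].
  by rewrite E; vec.
- right; left; have [] := @det_inj _ _ _ s t 0 1 ef0; last by [].
  by rewrite E; vec.
- right; left; have [] := @det_inj _ _ _ s t 0 (-1) ef0; last by [].
  by rewrite E; vec.
- right; right; left; apply: (det_inj ef0); exact: E.
- right; right; right; apply: (det_inj ef0); rewrite E; vec.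
Qed.

(** Points of the open cone spanned by [e] and [w] have positive coordinates on [e] and [f], so a
    vertex there could only be [w], which is on the boundary of the cone. *)
Lemma edge_ew s t : s + t <= N (s *: e + t *: w).
Proof.
apply: edge_norm_ge s t => //.
  have -> : det e w = b * det e f by rewrite /w /det !planeE; ring.
  by rewrite mulf_neq0 // lt0r_neq0.
move=> s t s0 t0.
have -> : s *: e + t *: w = (s + t * a) *: e + (t * b) *: f by rewrite /w; vec.
have ta := mulr_gt0 t0 a0; have tb := mulr_gt0 t0 b0.
case/vert_coord => [|[|[[sa]|[? E2]]]];
  [lra|lra| |by have := b0; lra].
move/(canRL (mulfK (lt0r_neq0 b0))); rewrite divff ?lt0r_neq0// => t1.
by move: sa; rewrite t1; lra.
Qed.

Lemma edge_wf s t : s + t <= N (s *: w + t *: f).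
Proof.
apply: edge_norm_ge s t => //.
  have -> : det w f = a * det e f by rewrite /w /det !planeE; ring.
  by rewrite mulf_neq0 // lt0r_neq0.
move=> s t s0 t0.
have -> : s *: w + t *: f = (s * a) *: e + (t + s * b) *: f by rewrite /w; vec.
have sa := mulr_gt0 s0 a0; have sb := mulr_gt0 s0 b0.
case/vert_coord => [|[|[[]|[E2]]]];
  [lra|lra| |by have := a0; lra].
move/(canRL (mulfK (lt0r_neq0 a0))); rewrite divff ?lt0r_neq0// => s1.
by rewrite s1; lra.
Qed.

(** In this open cone the coordinates on [e] and [f] have strictly opposite signs, which no vertex
    allows. *)
Lemma edge_fe s t : s + t <= N (s *: f + t *: - e).
Proof.
apply: edge_norm_ge s t => //; last 1 first.
- move=> s t s0 t0.
  have -> : s *: f + t *: - e = (- t) *: e + s *: f by vec.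
  have ha := a0; have hb := b0.
  by case/vert_coord => [|[|[[? E1]|[? E2]]]]; lra.
- have -> : det f (- e) = det e f by rewrite /det !planeE; ring.
  exact: ef0.
- by rewrite normN.
Qed.

Lemma radon_hexagon_coord : is_radon N -> a = 1 /\ b = 1.
Proof.
move=> radon.
have NNe : N (- e) = 1 by rewrite normN.
have NNf : N (- f) = 1 by rewrite normN.
have edge_ef : forall s t, s + t <= N (s *: (- f) + t *: e).
  by move=> s t; have := edge_norm_geN edge_fe s t; rewrite opprK.
have efe : birkhoff_james N (e + f) (1 *: e + 0 *: w).
  rewrite scale1r scale0r addr0; apply: radon.
  have := @bj_edge _ _ NNf Ne edge_ef 0 1 1 (lexx _) ler01.
  by rewrite scale0r add0r !scale1r opprK.
have eff : birkhoff_james N (e + f) (0 *: w + 1 *: f).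
  rewrite scale1r scale0r add0r; apply: radon.
  have := @bj_edge _ _ Nf NNe edge_fe 1 0 (-1) ler01 (lexx _).
  by rewrite scale0r addr0 scale1r scaleN1r opprB opprK addrC.
have bN0 := lt0r_neq0 b0; have aN0 := lt0r_neq0 a0.
have ab : a = b.
  (* If [b < a], then [e + f] is interior to the cone of [w] and [f], and [f] is not along that
     edge; if [a < b], the same holds for the cone of [e] and [w], with [e]. *)
  apply/eqP; rewrite eq_le !leNgt; apply/andP; split; apply/negP => ltab.
    have E : e + f = a^-1 *: w + (1 - b / a) *: f by rewrite /w; vec.
    have s0 : 0 < a^-1 by rewrite invr_gt0.
    have t0 : 0 < 1 - b / a by rewrite subr_gt0 ltr_pdivrMr// mul1r.
    rewrite E in eff.
    by have := bj_edge_interior Nw Nf edge_wf s0 t0 eff; lra.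
  have E : e + f = (1 - a / b) *: e + b^-1 *: w by rewrite /w; vec.
  have s0 : 0 < 1 - a / b by rewrite subr_gt0 ltr_pdivrMr// mul1r.
  have t0 : 0 < b^-1 by rewrite invr_gt0.
  rewrite E in efe.
  by have := bj_edge_interior Ne Nw edge_ew s0 t0 efe; lra.
have wee : birkhoff_james N (w - e) e.
  apply: radon.
  have := @bj_edge _ _ Ne Nw edge_ew 1 0 1 ler01 (lexx _).
  by rewrite scale0r addr0 !scale1r.
suff a1 : a = 1 by rewrite -ab.
(* The vector [w - e] is interior to the cone of [w] and [f] if [a > 1], and to that of [f] and [-e]
   if [a < 1]; in neither case is [e] along the edge. *)
apply/eqP; rewrite eq_le !leNgt; apply/andP; split; apply/negP => a1.
  have E : w - e = (1 - a^-1) *: w + 1 *: f by rewrite /w -ab; vec.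
  have E' : e = a^-1 *: w + (-1) *: f by rewrite /w -ab; vec.
  have s0 : 0 < 1 - a^-1 by rewrite subr_gt0 invf_lt1.
  rewrite E E' in wee.
  have := bj_edge_interior Nw Nf edge_wf s0 ltr01 wee.
  have : a^-1 < 1 by rewrite invf_lt1.
  lra.
have E : w - e = a *: f + (1 - a) *: - e by rewrite /w -ab; vec.
have E' : e = 0 *: f + (-1) *: - e by vec.
have s0 : 0 < 1 - a by rewrite subr_gt0.
rewrite E {2}E' in wee.
by have := bj_edge_interior Nf NNe edge_fe a0 s0 wee; lra.
Qed.

Lemma hexagon_radon : a = 1 -> b = 1 -> is_radon N.
Proof.
move=> a1 b1.
have wE : w = e + f by rewrite /w a1 b1 !scale1r.
have bound (x1 x2 : R) : let n := N (x1 *: e + x2 *: f) in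
    [/\ `|x1| <= n, `|x2| <= n & `|x1 - x2| <= n].
  (* [y1], [y2] and [y2 - y1] are the functionals equal to 1 on the edges from [e] to [w], [w] to
     [f] and [f] to [-e]. *)
  have half (y1 y2 : R) : let n := N (y1 *: e + y2 *: f) in
      [/\ y1 <= n, y2 <= n & y2 - y1 <= n].
    split.
    - have := edge_ew (y1 - y2) y2; rewrite wE subrK => /le_trans; apply.
      by rewrite le_eqVlt; apply/orP; left; apply/eqP; congr N; vec.
    - have := edge_wf y1 (y2 - y1); rewrite wE addrC subrK => /le_trans; apply.
      by rewrite le_eqVlt; apply/orP; left; apply/eqP; congr N; vec.
    - have := edge_fe y2 (- y1) => /le_trans; apply.
      by rewrite le_eqVlt; apply/orP; left; apply/eqP; congr N; vec.
  have [h1 h2 h3] := half x1 x2.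
  have := half (- x1) (- x2); rewrite !scaleNr -opprD normN// => -[h4 h5 h6].
  by split; rewrite ler_norml; lra.
have detE (x1 x2 y1 y2 : R) : det (x1 *: e + x2 *: f) (y1 *: e + y2 *: f) =
    det e f * (x1 * y2 - x2 * y1) by rewrite /det !planeE; ring.
apply: (@radon_of_det `|det e f|).
- by rewrite normr_gt0.
- move=> x y; have [x1 [x2 ->]] := det_decomp x ef0.
  have [y1 [y2 ->]] := det_decomp y ef0.
  rewrite detE normrM; apply: ler_wpM2l => //.
  have [h1 h2 h3] := bound x1 x2; have [k1 k2 k3] := bound y1 y2.
  exact: hexagon_det_le.
move=> y; have [y1 [y2 ->]] := det_decomp y ef0.
set n := N _.
have n1 : n <= `|y1| + `|y2|.
  by have := norm_comb hN y1 y2 e f; rewrite Ne Nf !mulr1.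
have n2 : n <= `|y1 - y2| + `|y2|.
  have := norm_comb hN (y1 - y2) y2 e w; rewrite Ne Nw !mulr1.
  by rewrite (_ : _ + _ = y1 *: e + y2 *: f)// wE; vec.
have n3 : n <= `|y1| + `|y2 - y1|.
  have := norm_comb hN y1 (y2 - y1) w f; rewrite Nf Nw !mulr1.
  by rewrite (_ : _ + _ = y1 *: e + y2 *: f)// wE; vec.
(* In each sign pattern one of the three triangle inequalities collapses to a single absolute value.
   The determinants with [e], [f] and [w] then recover the three functionals. *)
have : [\/ n <= `|y2|, n <= `|y1| | n <= `|y2 - y1|].
  have [|h2] := leP n `|y2|; first by constructor 1.
  have [|h1] := leP n `|y1|; first by constructor 2.
  constructor 3; move: n1 n2 n3 h1 h2; rewrite (distrC y1).
  case: (ler0P y1) => ?; case: (ler0P y2) => ?; case: (ler0P (y2 - y1)) => ?;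
  lra.
case=> le_n.
- exists e => //; rewrite (_ : det _ (y1 *: e + _) = det e f * y2).
    by rewrite normrM; apply: ler_wpM2l.
  by rewrite /det !planeE; ring.
- exists f => //; rewrite (_ : det _ (y1 *: e + _) = det e f * - y1).
    by rewrite normrM normrN; apply: ler_wpM2l.
  by rewrite /det !planeE; ring.
- exists w => //; rewrite (_ : det _ (y1 *: e + _) = det e f * (y2 - y1)).
    by rewrite normrM; apply: ler_wpM2l.
  by rewrite wE /det !planeE; ring.
Qed.

End hexagon.
End radon.

(** * Sign changes and the third pair of vertices *)

Lemma pm_opp (R : realType) (V : lmodType R) (v : V) : pm (- v) = pm v.
Proof. by rewrite /pm opprK setUC. Qed.

Lemma pm_sg (R : realType) (V : lmodType R) (a : R) (v : V) :
  a != 0 -> pm (Num.sg a *: v) = pm v.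
Proof.
by case: sgrP => // _ _; rewrite ?scale1r// scaleN1r pm_opp.
Qed.

Lemma pm_eq (R : realType) (V : lmodType R) (u v : V) :
  pm u = pm v <-> pm v u.
Proof.
split=> [<-|[]->]; [by left|by []|exact: pm_opp].
Qed.

(** Multiplying [e] and [f] by the signs of [a] and [b] makes the coordinates of the third vertex
    positive and preserves the pairs of vertices. *)
Lemma radon_hexagon (R : realType) (N : plane R -> R) (e f : plane R)
    (a b : R) :
  is_norm N -> det e f != 0 -> a != 0 -> b != 0 ->
  N e = 1 -> N f = 1 -> N (a *: e + b *: f) = 1 ->
  vertices N `<=` pm e `|` pm f `|` pm (a *: e + b *: f) ->
  is_radon N <-> `|a| = 1 /\ `|b| = 1.
Proof.
move=> hN ef0 a0 b0 Ne Nf Nw vert.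
have sgN c : c != 0 -> `|Num.sg c| = 1 by move=> c0; rewrite normr_sg c0.
pose e' := Num.sg a *: e; pose f' := Num.sg b *: f.
have wE : `|a| *: e' + `|b| *: f' = a *: e + b *: f.
  by rewrite /e' /f' !scalerA ![`|_| * _]mulrC -!numEsg.
have ef0' : det e' f' != 0.
  have -> : det e' f' = Num.sg a * Num.sg b * det e f.
    by rewrite /det !planeE; ring.
  by rewrite !mulf_neq0// sgr_eq0.
have Ne' : N e' = 1 by rewrite (norm_scale hN) sgN// mul1r.
have Nf' : N f' = 1 by rewrite (norm_scale hN) sgN// mul1r.
have a0' : 0 < `|a| by rewrite normr_gt0.
have b0' : 0 < `|b| by rewrite normr_gt0.
rewrite -wE in Nw vert.
rewrite -(pm_sg e a0) -(pm_sg f b0) -/e' -/f' in vert.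
by split=> [/(radon_hexagon_coord hN ef0' a0' b0' Ne' Nf' Nw vert)|[]] //;
  exact: (hexagon_radon hN ef0' a0' b0' Ne' Nf' Nw vert).
Qed.

(** Four elements cannot exhaust [A], so some [w] is left, and so is [- w]; any further element
    would be a seventh. *)
Lemma card6_third_pair (R : realType) (V : lmodType R) (A : set V) (p q : V) :
  (A #= `I_6)%card -> (forall x, A x -> A (- x)) -> ~ A 0 -> ~ pm p q ->
  pm p `|` pm q `<=` A ->
  exists w, A `\` (pm p `|` pm q) = pm w.
Proof.
move=> A6 AN A0 pq pqA.
have finA : finite_set A by apply/finite_setP; exists 6%N.
have [s sA [us s6]] : exists2 s : seq V, A = [set` s] & uniq s /\ size s = 6%N.
  exists (finmap.enum_fset (fset_set A)); first by rewrite -[LHS]fset_setK.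
  by split; [exact: finmap.fset_uniq|exact: card_fset_set].
have neqN x : A x -> x != - x.
  move=> Ax; apply/eqP => xN.
  have : (2 : R) *: x = 0 by rewrite scaler_nat mulr2n {1}xN addNr.
  by move/eqP; rewrite scaler_eq0 pnatr_eq0 /= => /eqP x0; rewrite x0 in Ax.
have pmP (x y : V) : reflect (pm x y) (y \in [:: x; - x]).
  by rewrite !inE; apply: (iffP orP) => -[/eqP|/eqP]; [left|right|left|right].
have [w [Aw pqw]] : exists w, A w /\ ~ (pm p `|` pm q) w.
  apply: contrapT => noW.
  suff : (size s <= size [:: p; - p; q; - q])%N by rewrite s6.
  apply: uniq_leq_size us _ => x xs.
  have Ax : A x by rewrite sA.
  have [] : (pm p `|` pm q) x by apply: contrapT => ?; apply: noW; exists x.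
    by move/pmP; rewrite !inE => /orP[] ->; rewrite ?orbT.
  by move/pmP; rewrite !inE => /orP[] ->; rewrite ?orbT.
exists w; apply/seteqP; split=> [x [Ax pqx]|x []->]; last 2 first.
- by [].
- split; first exact: AN.
  by move=> [[]|[]] /(canRL opprK) wE; apply: pqw; rewrite wE ?opprK;
    [left;right|left;left|right;right|right;left].
apply: contrapT => wx.
suff : (size [:: p; - p; q; - q; w; - w; x] <= size s)%N by rewrite s6.
have neq (u v : V) : ~ pm u v -> ((u == v) = false) * ((u == - v) = false).
  move=> uv; split; apply/eqP => E; apply: uv; rewrite E; first by left.
  by right; rewrite opprK.
have Np := negbTE (neqN _ (pqA _ (or_introl (or_introl erefl)))).
have Nq := negbTE (neqN _ (pqA _ (or_intror (or_introl erefl)))).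
have Nw := negbTE (neqN _ Aw).
have npq := neq _ _ pq.
have [npw nqw] : ~ pm p w /\ ~ pm q w.
  by split=> ?; apply: pqw; [left|right].
have [npx nqx] : ~ pm p x /\ ~ pm q x.
  by split=> ?; apply: pqx; [left|right].
apply: uniq_leq_size => [|y].
  rewrite /= !inE !eqr_opp !eqr_oppLR Np Nq Nw !npq.
  by rewrite !(neq _ _ npw) !(neq _ _ nqw) !(neq _ _ npx) !(neq _ _ nqx)
    !(neq _ _ wx).
have As z : A z -> z \in s by rewrite sA.
have sw : A (- w) by exact: AN.
rewrite !inE => /or4P[/eqP->|/eqP->|/eqP->|/or4P[/eqP->|/eqP->|/eqP->|/eqP->]];
  apply: As => //; apply: pqA.
- by left; left.
- by left; right.
- by right; left.
- by right; right.
Qed.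

(** * Hexagons with two given pairs of vertices *)

Unset Implicit Arguments.
Set Strict Implicit.

Theorem theorem2p9 (R : realType) (alpha : R) (N : plane R -> R) :
  0 < alpha ->
  is_norm N ->
  is_hexagon N ->
  pm (pt 1 alpha) `|` pm (pt 1 (- alpha)) `<=` vertices N ->
  is_radon N <->
    (vertices N `\` (pm (pt 1 alpha) `|` pm (pt 1 (- alpha)))
       = pm (pt 0 (2 * alpha))
     \/
     vertices N `\` (pm (pt 1 alpha) `|` pm (pt 1 (- alpha)))
       = pm (pt 2 0)).
Proof.
move=> alpha0 hN hex pqV.
set p := pt 1 alpha; set q := pt 1 (- alpha).
have Vp : vertices N p by apply: pqV; left; left.
have Vq : vertices N q by apply: pqV; right; left.
have p0 : p != 0 by apply/eqP => /(congr1 fst)/eqP; rewrite oner_eq0.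
have N1 x : vertices N x -> N x = 1 by exact: (vertex_norm1 hN p0).
have detpq : det p q != 0.
  by rewrite /det /= mulr1 mul1r -opprD oppr_eq0 lt0r_neq0// addr_gt0.
have aN0 := lt0r_neq0 alpha0.
have inj := @det_inj _ p q _ _ _ _ detpq.
have pq : ~ pm p q.
  move=> [] E.
    by have [|/eqP] := inj 0 1 1 0; [rewrite E; vec|rewrite eq_sym oner_eq0].
  by have [|_ /eqP] := inj 0 1 (-1) 0; [rewrite E; vec|rewrite oner_eq0].
have nV0 : ~ vertices N 0.
  by move/N1/eqP; rewrite norm0// eq_sym oner_eq0.
have [w Ew] := card6_third_pair hex (fun x => @vertexN _ _ hN x) nV0 pq pqV.
rewrite Ew.
have [Vw pqw] : (vertices N `\` (pm p `|` pm q)) w by rewrite Ew; left.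
have [a [b wE]] := det_decomp w detpq.
have Nw := N1 _ Vw.
(* Vertices have norm 1, so proportional ones agree up to sign; hence [w] has two nonzero
   coordinates on [p] and [q]. *)
have multiple (c : R) (u : plane R) : vertices N u -> w = c *: u -> pm u w.
  move=> Vu E; have := Nw; rewrite E (norm_scale hN) (N1 _ Vu) mulr1.
  by case: (ler0P c) => _ => [/(canRL opprK)|] ->; [right|left];
    rewrite ?scaleN1r ?scale1r.
have a0 : a != 0.
  apply/eqP => a0; apply: pqw; right; apply: (multiple b) => //.
  by rewrite wE a0 scale0r add0r.
have b0 : b != 0.
  apply/eqP => b0; apply: pqw; left; apply: (multiple a) => //.
  by rewrite wE b0 scale0r addr0.
have vert : vertices N `<=` pm p `|` pm q `|` pm (a *: p + b *: q).
  move=> x Vx; have [xpq|xpq] := pselect ((pm p `|` pm q) x); first by left.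
  by right; rewrite -wE -Ew.
rewrite wE in Nw.
have -> := radon_hexagon hN detpq a0 b0 (N1 _ Vp) (N1 _ Vq) Nw vert.
(* Equal signs of [a] and [b] give [p + q = (2, 0)] up to sign, and opposite signs give
   [p - q = (0, 2 alpha)]. *)
rewrite !pm_eq wE; split.
  move=> []; case: (ler0P a) => _; case: (ler0P b) => _.
  - move=> /(canRL opprK) -> /(canRL opprK) ->; right; right; vec.
  - move=> /(canRL opprK) -> ->; left; right; vec.
  - move=> -> /(canRL opprK) ->; left; left; vec.
  - move=> -> ->; right; left; vec.
move=> [[]|[]] E.
- have [|-> ->] := inj a b 1 (-1); first by rewrite E; vec.
  by rewrite normrN normr1.
- have [|-> ->] := inj a b (-1) 1; first by rewrite E; vec.
  by rewrite normrN normr1.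
- have [|-> ->] := inj a b 1 1; first by rewrite E; vec.
  by rewrite normr1.
have [|-> ->] := inj a b (-1) (-1); first by rewrite E; vec.
by rewrite normrN normr1.
Qed.
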